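(* Let $(A,\Delta,\diamond,\circ)$ be a Hopf truss over a field $\mathbb{K}$ with cocycle $\sigma$, and let $S$ be the antipode of $(A,\Delta,\diamond)$. For any grouplike element $e$ in $(A,\Delta,\diamond)$, define a binary operation $\diamond_e$ on $A$ by $$a\diamond_e b = a\diamond S(e)\diamond b.$$ Then $(A,\Delta,\diamond_e)$ is a Hopf algebra with identity $e$ and antipode $S_e(a) = e\diamond S(a)\diamond e$. Furthermore, $(A,\Delta,\diamond_e,\circ)$ is a Hopf truss with cocycle $\sigma_e(a) = a\circ e$.
   Context: Sweedler notation $\Delta(a) = \sum a_{(1)}\otimes a_{(2)}$ is used. A (left) Hopf truss consists of a coalgebra $(A,\Delta,\varepsilon)$ over a field $\mathbb{K}$, a bilinear operation $\diamond$ making $(A,\Delta,\varepsilon)$ a Hopf algebra with identity $1_\diamond$ and antipode $S$, a bilinear operation $\circ$ making $(A,\Delta,\varepsilon)$ a non-unital bialgebra (i.e. $\circ:A\otimes A\to A$ is an associative morphism of coalgebras), and a coalgebra endomorphism $\sigma$ of $(A,\Delta,\varepsilon)$, called the cocycle, such that for all $a,b,c\in A$, $a\circ(b\diamond c) = \sum(a_{(1)}\circ b)\diamond S\sigma(a_{(2)})\diamond(a_{(3)}\circ c)$. An element $e$ is grouplike if $\Delta(e)=e\otimes e$ and $\varepsilon(e)=1$. *)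

(* Defs.v *)
From HB Require Import structures.
From mathcomp Require Import all_boot all_algebra.
From mathcomp Require Import boolp.

Set Implicit Arguments.
Unset Strict Implicit.
Unset Printing Implicit Defensive.

Import GRing.Theory.
Local Open Scope ring_scope.
Local Open Scope quotient_scope.

Definition is_bilinear (K : fieldType) (A B U : lmodType K)
  (f : A -> B -> U) : Prop := bilinear_for *:%R *:%R f.

Section Tensor.
Variables (K : fieldType) (A B : lmodType K).

(* A sequence [:: (a1, b1); ...; (an, bn)] stands for the formal sum          *)
(* a1 (x) b1 + ... + an (x) bn. Two such sums denote the same tensor iff they *)
(* are related by the congruence generated by the relations of A (x)_K B.     *)
Inductive tensor_eq : seq (A * B) -> seq (A * B) -> Prop :=
| tensor_eq_refl s : tensor_eq s s
| tensor_eq_sym s t : tensor_eq s t -> tensor_eq t s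
| tensor_eq_trans s t u : tensor_eq s t -> tensor_eq t u -> tensor_eq s u
| tensor_eq_cat s s' t t' :
    tensor_eq s s' -> tensor_eq t t' -> tensor_eq (s ++ t) (s' ++ t')
| tensor_eq_catC s t : tensor_eq (s ++ t) (t ++ s)
| tensor_eq_addl a a' b : tensor_eq [:: (a + a', b)] [:: (a, b); (a', b)]
| tensor_eq_addr a b b' : tensor_eq [:: (a, b + b')] [:: (a, b); (a, b')]
| tensor_eq_scale k a b : tensor_eq [:: (k *: a, b)] [:: (a, k *: b)]
| tensor_eq_zero b : tensor_eq [:: (0, b)] [::].

Definition tensor_eqb (s t : seq (A * B)) : bool := `[< tensor_eq s t >].

Fact tensor_eqb_refl : reflexive tensor_eqb.
Proof. by move=> s; apply/asboolP; apply: tensor_eq_refl. Qed.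

Fact tensor_eqb_sym : symmetric tensor_eqb.
Proof. by move=> s t; apply/asboolP/asboolP; apply: tensor_eq_sym. Qed.

Fact tensor_eqb_trans : transitive tensor_eqb.
Proof.
move=> t s u /asboolP st /asboolP tu; apply/asboolP.
exact: tensor_eq_trans st tu.
Qed.

Canonical tensor_equiv :=
  EquivRel tensor_eqb tensor_eqb_refl tensor_eqb_sym tensor_eqb_trans.

Definition tensor := {eq_quot tensor_equiv}.
HB.instance Definition _ := Choice.on tensor.
HB.instance Definition _ := EqQuotient.on tensor.

Lemma tensor_eqP (s t : seq (A * B)) :
  tensor_eq s t <-> \pi_tensor s = \pi_tensor t.
Proof.
split=> [st|]; first by apply/eqquotP; apply/asboolP.
by move/eqquotP/asboolP.
Qed.

Lemma tensor_eq_repr (s : seq (A * B)) : tensor_eq (repr (\pi_tensor s)) s.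
Proof. by apply/tensor_eqP; rewrite reprK. Qed.

Definition tensor_zero : tensor := \pi_tensor [::].
Definition tensor_add (x y : tensor) : tensor :=
  \pi_tensor (repr x ++ repr y).
Definition tensor_scale (k : K) (x : tensor) : tensor :=
  \pi_tensor [seq (k *: p.1, p.2) | p <- repr x].
Definition tensor_opp (x : tensor) : tensor := tensor_scale (-1) x.

Lemma tensor_addE (s t : seq (A * B)) :
  tensor_add (\pi_tensor s) (\pi_tensor t) = \pi_tensor (s ++ t).
Proof. by apply/tensor_eqP; apply: tensor_eq_cat; apply: tensor_eq_repr. Qed.

Lemma tensor_eq_map (k : K) (s t : seq (A * B)) : tensor_eq s t ->
  tensor_eq [seq (k *: p.1, p.2) | p <- s] [seq (k *: p.1, p.2) | p <- t].
Proof.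
elim=> {s t}; rewrite /=.
- by move=> s; apply: tensor_eq_refl.
- by move=> s t _; apply: tensor_eq_sym.
- by move=> s t u _ st _; apply: tensor_eq_trans.
- by move=> s s' t t' _ ss' _ tt'; rewrite !map_cat; apply: tensor_eq_cat.
- by move=> s t; rewrite !map_cat; apply: tensor_eq_catC.
- by move=> a a' b; rewrite scalerDr; apply: tensor_eq_addl.
- by move=> a b b'; apply: tensor_eq_addr.
- move=> l a b; rewrite scalerA mulrC -scalerA; exact: tensor_eq_scale.
- by move=> b; rewrite scaler0; apply: tensor_eq_zero.
Qed.

Lemma tensor_scaleE (k : K) (s : seq (A * B)) :
  tensor_scale k (\pi_tensor s) = \pi_tensor [seq (k *: p.1, p.2) | p <- s].
Proof. by apply/tensor_eqP; apply: tensor_eq_map; apply: tensor_eq_repr. Qed.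

Lemma tensor_eq_mapD (k l : K) (s : seq (A * B)) :
  tensor_eq [seq ((k + l) *: p.1, p.2) | p <- s]
    ([seq (k *: p.1, p.2) | p <- s] ++ [seq (l *: p.1, p.2) | p <- s]).
Proof.
elim: s => [|[a b] s ih] /=; first exact: tensor_eq_refl.
rewrite scalerDl; set skl := [seq _ | _ <- s] in ih *.
set sk := [seq _ | _ <- s] in ih *; set sl := [seq _ | _ <- s] in ih *.
apply: (@tensor_eq_trans _ ([:: (k *: a, b); (l *: a, b)] ++ (sk ++ sl))).
  by rewrite -cat1s; apply: tensor_eq_cat (tensor_eq_addl _ _ _) ih.
apply: (@tensor_eq_cat [:: _] [:: _] (_ :: _)); first exact: tensor_eq_refl.
rewrite -[X in tensor_eq X _]cat1s -[X in tensor_eq _ (_ ++ X)]cat1s !catA.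
apply: tensor_eq_cat; [exact: tensor_eq_catC | exact: tensor_eq_refl].
Qed.

Fact tensor_addA : associative tensor_add.
Proof.
move=> x y z; rewrite -(reprK x) -(reprK y) -(reprK z).
rewrite (tensor_addE (repr y)) (tensor_addE (repr x) (repr y)).
by rewrite !tensor_addE catA.
Qed.

Fact tensor_addC : commutative tensor_add.
Proof.
move=> x y; rewrite -(reprK x) -(reprK y) !tensor_addE.
by apply/tensor_eqP; apply: tensor_eq_catC.
Qed.

Fact tensor_add0 : left_id tensor_zero tensor_add.
Proof. by move=> x; rewrite -(reprK x) tensor_addE. Qed.

Fact tensor_addN : left_inverse tensor_zero tensor_opp tensor_add.
Proof.
move=> x; rewrite -(reprK x) /tensor_opp tensor_scaleE tensor_addE.
apply/tensor_eqP; move: (repr x) => s.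
have {2}-> : s = [seq (1 *: p.1, p.2) | p <- s].
  by rewrite -[LHS]map_id; apply: eq_map => -[a b]; rewrite scale1r.
apply: tensor_eq_trans; first by apply: tensor_eq_sym; apply: tensor_eq_mapD.
elim: s => [|[a b] s ih] /=; first exact: tensor_eq_refl.
rewrite -cat1s -[X in tensor_eq _ X](cats0 [::]); apply: tensor_eq_cat => //.
by rewrite addNr scale0r; apply: tensor_eq_zero.
Qed.

HB.instance Definition _ := GRing.isZmodule.Build tensor
  tensor_addA tensor_addC tensor_add0 tensor_addN.

Fact tensor_scaleA (k l : K) (x : tensor) :
  tensor_scale k (tensor_scale l x) = tensor_scale (k * l) x.
Proof.
rewrite -(reprK x) (tensor_scaleE l) !tensor_scaleE -map_comp.
congr (\pi_tensor _).
by apply: eq_map => p /=; rewrite scalerA.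
Qed.

Fact tensor_scale1 : left_id 1 tensor_scale.
Proof.
move=> x; rewrite -(reprK x) tensor_scaleE; congr (\pi_tensor _).
by rewrite -[RHS]map_id; apply: eq_map => -[a b]; rewrite scale1r.
Qed.

Fact tensor_scaleDr : right_distributive tensor_scale +%R.
Proof.
move=> k x y; rewrite -(reprK x) -(reprK y).
rewrite /GRing.add /= (tensor_addE (repr x)) !tensor_scaleE.
by rewrite (tensor_addE [seq _ | _ <- repr x]) map_cat.
Qed.

Fact tensor_scaleDl (x : tensor) : {morph tensor_scale^~ x : k l / k + l}.
Proof.
move=> k l; rewrite -(reprK x) [RHS]/GRing.add /= !tensor_scaleE tensor_addE.
by apply/tensor_eqP; apply: tensor_eq_mapD.
Qed.

HB.instance Definition _ := GRing.Zmodule_isLmodule.Build K tensor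
  tensor_scaleA tensor_scale1 tensor_scaleDr tensor_scaleDl.

Lemma tensor_piD (s t : seq (A * B)) :
  \pi_tensor s + \pi_tensor t = \pi_tensor (s ++ t).
Proof. exact: tensor_addE. Qed.

Lemma tensor_piZ (k : K) (s : seq (A * B)) :
  k *: \pi_tensor s = \pi_tensor [seq (k *: p.1, p.2) | p <- s].
Proof. exact: tensor_scaleE. Qed.

Definition tens (a : A) (b : B) : tensor := \pi_tensor [:: (a, b)].

(* The linear map A (x) B -> U induced by f, i.e. the Sweedler-style sum      *)
(* \sum f(x_1, x_2) for x = \sum x_1 (x) x_2. It is only meaningful for       *)
(* bilinear f, where it is independent of the representative (tlift_pi).      *)
Definition tlift (U : lmodType K) (f : A -> B -> U) (x : tensor) : U :=
  \sum_(p <- repr x) f p.1 p.2.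

Lemma tens_bilinear : is_bilinear tens.
Proof.
split=> [b k a a' | a k b b']; rewrite /= /tens tensor_piZ tensor_piD;
  apply/tensor_eqP.
  exact: tensor_eq_addl.
apply: tensor_eq_trans; first exact: tensor_eq_addr.
rewrite -cat1s -[X in tensor_eq _ X]cat1s.
apply: tensor_eq_cat; last exact: tensor_eq_refl.
by apply: tensor_eq_sym; apply: tensor_eq_scale.
Qed.

Lemma tens_sum (x : tensor) : x = \sum_(p <- repr x) tens p.1 p.2.
Proof.
rewrite -[LHS]reprK; elim: (repr x) => [|[a b] s ih]; first by rewrite big_nil.
by rewrite big_cons -ih tensor_piD.
Qed.

Section Lift.
Variables (U : lmodType K) (f : A -> B -> U).
Hypothesis fB : is_bilinear f.

Lemma bilinear_0l (b : B) : f 0 b = 0.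
Proof.
by have := fB.1 b (-1) 0 0; rewrite /= scaleN1r oppr0 addr0 scaleN1r addNr.
Qed.

Lemma bilinear_0r (a : A) : f a 0 = 0.
Proof.
by have := fB.2 a (-1) 0 0; rewrite /= scaleN1r oppr0 addr0 scaleN1r addNr.
Qed.

Lemma tensor_eq_sum (s t : seq (A * B)) : tensor_eq s t ->
  \sum_(p <- s) f p.1 p.2 = \sum_(p <- t) f p.1 p.2.
Proof.
elim=> {s t} //.
- by move=> s t u _ -> _ ->.
- by move=> s s' t t' _ ss' _ tt'; rewrite !big_cat /= ss' tt'.
- by move=> s t; rewrite !big_cat /= addrC.
- move=> a a' b; rewrite !big_cons !big_nil /= !addr0.
  by have := fB.1 b 1 a a'; rewrite /= !scale1r.
- move=> a b b'; rewrite !big_cons !big_nil /= !addr0.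
  by have := fB.2 a 1 b b'; rewrite /= !scale1r.
- move=> k a b; rewrite !big_cons !big_nil /= !addr0.
  have := fB.1 b k a 0; rewrite /= bilinear_0l !addr0 => ->.
  by have := fB.2 a k b 0; rewrite /= bilinear_0r !addr0 => ->.
- by move=> b; rewrite big_cons !big_nil /= addr0 bilinear_0l.
Qed.

Lemma tlift_pi (s : seq (A * B)) :
  tlift f (\pi_tensor s) = \sum_(p <- s) f p.1 p.2.
Proof. by apply: tensor_eq_sum; apply: tensor_eq_repr. Qed.

Lemma tlift_tens (a : A) (b : B) : tlift f (tens a b) = f a b.
Proof. by rewrite tlift_pi big_seq1. Qed.

Lemma tlift_linear : linear (tlift f).
Proof.
move=> k x y; rewrite -(reprK x) -(reprK y).
rewrite tensor_piZ tensor_piD !tlift_pi big_cat big_map /=.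
rewrite scaler_sumr; congr (_ + _); apply: eq_bigr => p _.
by have := fB.1 p.2 k p.1 0; rewrite /= bilinear_0l !addr0.
Qed.

Lemma tlift_unique (g : tensor -> U) : linear g ->
  (forall a b, g (tens a b) = f a b) -> g =1 tlift f.
Proof.
move=> gL gE x.
have gD y z : g (y + z) = g y + g z.
  by have := gL 1 y z; rewrite !scale1r.
have g0 : g 0 = 0.
  by have := gL (-1) 0 0; rewrite scaleN1r oppr0 addr0 scaleN1r addNr.
rewrite {1}(tens_sum x) (big_morph g gD g0).
by apply: eq_bigr => p _; apply: gE.
Qed.

End Lift.

End Tensor.

Arguments tensor {K} (A B)%_type_scope.

Notation "A ⊗ B" := (tensor A B) (at level 40, left associativity) : type_scope.
Notation "a ⊗ b" := (tens a b) (at level 40, left associativity) : ring_scope.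

Definition tmap (K : fieldType) (A A' B B' : lmodType K)
    (f : A -> A') (g : B -> B') : A ⊗ B -> A' ⊗ B' :=
  tlift (fun a b => f a ⊗ g b).

Definition tassoc (K : fieldType) (A B C : lmodType K) :
    (A ⊗ B) ⊗ C -> A ⊗ (B ⊗ C) :=
  tlift (fun x c => tlift (fun a b => a ⊗ (b ⊗ c)) x).

(* \sum f(x_1, x_2, x_3) for x = \sum x_1 (x) x_2 (x) x_3.                    *)
Definition tlift3 (K : fieldType) (A B C U : lmodType K)
    (f : A -> B -> C -> U) : (A ⊗ B) ⊗ C -> U :=
  tlift (fun x c => tlift (fun a b => f a b c) x).

Section Coalgebra.
Variable K : fieldType.

Record is_coalgebra (C : lmodType K) (Delta : C -> C ⊗ C) (eps : C -> K^o) :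
    Prop := IsCoalgebra {
  coalg_comul_linear : linear Delta;
  coalg_counit_linear : linear eps;
  coalg_coassoc : forall c,
    tassoc (tmap Delta id (Delta c)) = tmap id Delta (Delta c);
  coalg_counitl : forall c,
    tlift (fun c1 c2 => (eps c1 : K) *: c2) (Delta c) = c;
  coalg_counitr : forall c,
    tlift (fun c1 c2 => (eps c2 : K) *: c1) (Delta c) = c
}.

Record is_coalg_morphism (C D : lmodType K)
    (DeltaC : C -> C ⊗ C) (epsC : C -> K^o)
    (DeltaD : D -> D ⊗ D) (epsD : D -> K^o) (f : C -> D) :
    Prop := IsCoalgMorphism {
  coalg_mor_linear : linear f;
  coalg_mor_comul : forall c, DeltaD (f c) = tmap f f (DeltaC c);
  coalg_mor_counit : forall c, epsD (f c) = epsC c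
}.

(* c (x) d |-> \sum (c_1 (x) d_1) (x) (c_2 (x) d_2)                           *)
Definition tens_comul (C D : lmodType K)
    (DeltaC : C -> C ⊗ C) (DeltaD : D -> D ⊗ D) :
    C ⊗ D -> (C ⊗ D) ⊗ (C ⊗ D) :=
  tlift (fun c d =>
    tlift (fun c1 c2 =>
      tlift (fun d1 d2 => (c1 ⊗ d1) ⊗ (c2 ⊗ d2)) (DeltaD d)) (DeltaC c)).

Definition tens_counit (C D : lmodType K)
    (epsC : C -> K^o) (epsD : D -> K^o) : C ⊗ D -> K^o :=
  tlift (fun c d => epsC c * epsD d : K^o).

Definition is_grouplike (C : lmodType K) (Delta : C -> C ⊗ C)
    (eps : C -> K^o) (e : C) : Prop :=
  Delta e = e ⊗ e /\ eps e = 1.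

Variables (A : lmodType K) (Delta : A -> A ⊗ A) (eps : A -> K^o).

Record is_nonunital_bialgebra (mul : A -> A -> A) : Prop :=
    IsNonunitalBialgebra {
  nubialg_coalgebra : is_coalgebra Delta eps;
  nubialg_bilinear : is_bilinear mul;
  nubialg_mulA : associative mul;
  nubialg_mul_coalg : is_coalg_morphism
    (tens_comul Delta Delta) (tens_counit eps eps) Delta eps (tlift mul)
}.

Record is_bialgebra (mul : A -> A -> A) (one : A) : Prop := IsBialgebra {
  bialg_nonunital : is_nonunital_bialgebra mul;
  bialg_mul1l : left_id one mul;
  bialg_mul1r : right_id one mul;
  bialg_comul1 : Delta one = one ⊗ one;
  bialg_counit1 : eps one = 1
}.

Record is_hopf_algebra (mul : A -> A -> A) (one : A) (S : A -> A) : Prop :=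
    IsHopfAlgebra {
  hopf_bialgebra : is_bialgebra mul one;
  hopf_antipode_linear : linear S;
  hopf_antipodel : forall a,
    tlift (fun a1 a2 => mul (S a1) a2) (Delta a) = (eps a : K) *: one;
  hopf_antipoder : forall a,
    tlift (fun a1 a2 => mul a1 (S a2)) (Delta a) = (eps a : K) *: one
}.

Record is_hopf_truss (dia : A -> A -> A) (one : A) (S : A -> A)
    (circ : A -> A -> A) (sigma : A -> A) : Prop := IsHopfTruss {
  truss_hopf : is_hopf_algebra dia one S;
  truss_circ : is_nonunital_bialgebra circ;
  truss_cocycle : is_coalg_morphism Delta eps Delta eps sigma;
  truss_distr : forall a b c,
    circ a (dia b c) =
    tlift3 (fun a1 a2 a3 => dia (dia (circ a1 b) (S (sigma a2))) (circ a3 c))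
      (tmap Delta id (Delta a))
}.

End Coalgebra.

(* Main.v *)
(* A grouplike e has the inverse S(e), again grouplike, so (a,b) |-> a S(e) b *)
(* is the product of A transported along left translation by e; this gives *)
(* the Hopf algebra. For the truss, work in the convolution algebra of linear *)
(* maps A -> A, with R_b(a) = a o b and T = S sigma: the truss axiom reads    *)
(*    R_(bc) = R_b * T * R_c.                                                 *)
(* As R_1 is a coalgebra map it is convolution invertible, and b = c = 1      *)
(* gives T * R_1 = 1, so R_1 = sigma. Then sigma = R_(e S(e)) = R_e * T *     *)
(* R_(S(e)), whence S R_e = T * R_(S(e)) * T, and therefore                   *)
(*    R_(b S(e) c) = R_b * T * R_(S(e)) * T * R_c = R_b * S R_e * R_c.        *)
Require Import Defs.
From mathcomp Require Import all_boot all_algebra boolp.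

Import GRing.Theory.
Local Open Scope ring_scope.

Set Implicit Arguments.
Unset Strict Implicit.
Unset Printing Implicit Defensive.

(** The Hopf algebra half is [hopf_algebra_grouplike], which rests on [S e] being a grouplike
    inverse of [e] ([grouplike_mulVg], [grouplike_mulgV], [grouplike_antipode]). For the truss half,
    [conv3E] turns the truss axiom into an identity of maps; [truss_cocycleE] and
    [antipode_circ_grouplike] are then uniqueness-of-inverse arguments in the convolution algebra,
    and [truss_distr_grouplike] combines them. *)

(** * Linear and bilinear maps, and calculus of Sweedler sums *)

Section LinearMaps.
Variable K : fieldType.
Implicit Types U V W : lmodType K.

Lemma linear_sum_seq U V (f : U -> V) (I : Type) (s : seq I) (F : I -> U) :
  linear f -> f (\sum_(i <- s) F i) = \sum_(i <- s) f (F i).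
Proof.
move=> fL; apply: (big_morph f) => [x y|].
  by have := fL 1 x y; rewrite !scale1r.
by have := fL (-1) 0 0; rewrite scaleN1r oppr0 addr0 scaleN1r addNr.
Qed.

Lemma linear_scale U V (f : U -> V) (k : K) (x : U) :
  linear f -> f (k *: x) = k *: f x.
Proof.
move=> fL; have f0 : f 0 = 0.
  by have := fL (-1) 0 0; rewrite scaleN1r oppr0 addr0 scaleN1r addNr.
by have := fL k x 0; rewrite f0 !addr0.
Qed.

Lemma linear_comp U V W (f : V -> W) (g : U -> V) :
  linear f -> linear g -> linear (fun x => f (g x)).
Proof. by move=> fL gL k x y; rewrite gL fL. Qed.

Lemma linear_ident U : linear (fun x : U => x). Proof. by []. Qed.

Lemma bilinear_intro U V W (f : U -> V -> W) :
  (forall b, linear (fun a => f a b)) -> (forall a, linear (f a)) ->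
  is_bilinear f.
Proof. by move=> fl fr; split=> [b k x y|a k x y]; [apply: fl|apply: fr]. Qed.

Lemma bilinear_linl U V W (f : U -> V -> W) (b : V) :
  is_bilinear f -> linear (fun a => f a b).
Proof. by move=> fB k x y; have := fB.1 b k x y. Qed.

Lemma bilinear_linr U V W (f : U -> V -> W) (a : U) :
  is_bilinear f -> linear (f a).
Proof. by move=> fB k x y; have := fB.2 a k x y. Qed.

Lemma bilinear_scalel U V W (f : U -> V -> W) k a b :
  is_bilinear f -> f (k *: a) b = k *: f a b.
Proof. by move=> /(bilinear_linl b) /(linear_scale k a). Qed.

Lemma bilinear_scaler U V W (f : U -> V -> W) k a b :
  is_bilinear f -> f a (k *: b) = k *: f a b.
Proof. by move=> /(bilinear_linr a) /(linear_scale k b). Qed.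

Lemma bilinear_comp2 U V U' V' W (f : U' -> V' -> W) (g : U -> U')
    (h : V -> V') :
  is_bilinear f -> linear g -> linear h ->
  is_bilinear (fun a b => f (g a) (h b)).
Proof.
move=> fB gL hL; apply: bilinear_intro => c.
  exact: (linear_comp (bilinear_linl _ fB) gL).
exact: (linear_comp (bilinear_linr _ fB) hL).
Qed.

(** [tlift] sums over a chosen representative of [x], so two lifts at the same [x] compare term by
    term; bilinearity enters only when the representative changes. *)
Lemma eq_tlift U V W (f g : U -> V -> W) (x : U ⊗ V) :
  (forall a b, f a b = g a b) -> tlift f x = tlift g x.
Proof. by move=> fg; apply: eq_bigr => p _; apply: fg. Qed.

Lemma linear_tlift U V W W' (h : W -> W') (f : U -> V -> W) (x : U ⊗ V) :
  linear h -> h (tlift f x) = tlift (fun a b => h (f a b)) x.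
Proof. exact: linear_sum_seq. Qed.

Lemma tlift_tmap U V U' V' W (f : U' -> V' -> W) (g : U -> U') (h : V -> V')
    (x : U ⊗ V) :
  is_bilinear f -> tlift f (tmap g h x) = tlift (fun a b => f (g a) (h b)) x.
Proof.
move=> fB; rewrite /tmap (linear_tlift _ _ (tlift_linear fB)).
by apply: eq_tlift => a b; rewrite tlift_tens.
Qed.

Lemma tlift_bilinear_param U V U' V' W (f : U -> V -> U' -> V' -> W)
    (y : U' ⊗ V') :
  (forall a' b', is_bilinear (fun a b => f a b a' b')) ->
  is_bilinear (fun a b => tlift (f a b) y).
Proof.
move=> fB; apply: bilinear_intro => [b|a] k x x';
  rewrite /tlift scaler_sumr -big_split /=; apply: eq_bigr => i _.
  exact: (bilinear_linl _ (fB i.1 i.2)).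
exact: (bilinear_linr _ (fB i.1 i.2)).
Qed.

Lemma tlift_tlift_bilinear U V U' V' W (f : U -> V -> U' -> V' -> W) :
  (forall a' b', is_bilinear (fun a b => f a b a' b')) ->
  (forall a b, is_bilinear (f a b)) ->
  is_bilinear (fun (x : U ⊗ V) (y : U' ⊗ V') =>
    tlift (fun a b => tlift (f a b) y) x).
Proof.
move=> fB fB'; apply: bilinear_intro => [y|x k y y'].
  exact/tlift_linear/tlift_bilinear_param.
rewrite {1 2 3}/tlift scaler_sumr -big_split /=.
by apply: eq_bigr => i _; apply: tlift_linear.
Qed.

End LinearMaps.

(** * The convolution algebra of linear maps from a coalgebra to an algebra *)

Section Convolution.
Variables (K : fieldType) (C A : lmodType K).
Variables (Delta : C -> C ⊗ C) (eps : C -> K^o).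
Variables (mul : A -> A -> A) (one : A).
Hypotheses (hC : is_coalgebra Delta eps) (mulB : is_bilinear mul).
Hypotheses (mulA : associative mul) (mul1l : left_id one mul).
Hypothesis mul1r : right_id one mul.
Implicit Types F G H : C -> A.

Definition conv F G (c : C) : A :=
  tlift (fun c1 c2 => mul (F c1) (G c2)) (Delta c).

Definition conv_unit (c : C) : A := (eps c : K) *: one.

Lemma conv_linear F G : linear F -> linear G -> linear (conv F G).
Proof.
move=> FL GL; apply: linear_comp (coalg_comul_linear hC).
exact: tlift_linear (bilinear_comp2 mulB FL GL).
Qed.

(** Right multiplication by [H c3] is linear and so passes inside the inner sum. This is the bridge
    to the three-fold Sweedler sum of the truss axiom. *)
Lemma conv3E F G H : linear F -> linear G -> linear H ->
  forall c, conv (conv F G) H c =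
    tlift3 (fun c1 c2 c3 => mul (mul (F c1) (G c2)) (H c3))
      (tmap Delta id (Delta c)).
Proof.
move=> FL GL HL c; have FGB := bilinear_comp2 mulB FL GL.
have lift_mul (x : C ⊗ C) c3 :
    mul (tlift (fun c1 c2 => mul (F c1) (G c2)) x) (H c3) =
    tlift (fun c1 c2 => mul (mul (F c1) (G c2)) (H c3)) x.
  exact: (linear_tlift _ _ (bilinear_linl _ mulB)).
rewrite /tlift3 -(eq_tlift _ lift_mul) tlift_tmap //.
exact: bilinear_comp2 mulB (tlift_linear FGB) HL.
Qed.

Lemma convA F G H : linear F -> linear G -> linear H ->
  conv F (conv G H) = conv (conv F G) H.
Proof.
move=> FL GL HL; apply/funext => c.
have GHB := bilinear_comp2 mulB GL HL.
have mulFB : is_bilinear (fun c1 y => mul (F c1)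
    (tlift (fun c2 c3 => mul (G c2) (H c3)) y)).
  exact: bilinear_comp2 mulB FL (tlift_linear GHB).
rewrite conv3E // [LHS]/conv.
(* The right-bracketed product is a single lift evaluated at [tmap id Delta (Delta c)], the form to
   which coassociativity applies. *)
transitivity (tlift (fun c1 y => mul (F c1)
    (tlift (fun c2 c3 => mul (G c2) (H c3)) y)) (tmap id Delta (Delta c))).
  by rewrite tlift_tmap.
rewrite -(coalg_coassoc hC) /tassoc (linear_tlift _ _ (tlift_linear mulFB)).
apply: eq_tlift => x c3; rewrite (linear_tlift _ _ (tlift_linear mulFB)).
by apply: eq_tlift => c1 c2; rewrite tlift_tens // tlift_tens // mulA.
Qed.

Lemma conv1l F : linear F -> conv conv_unit F = F.
Proof.
move=> FL; apply/funext => c.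
rewrite -[in RHS](coalg_counitl hC c) (linear_tlift _ _ FL).
by apply: eq_tlift => a b; rewrite linear_scale // bilinear_scalel // mul1l.
Qed.

Lemma conv1r F : linear F -> conv F conv_unit = F.
Proof.
move=> FL; apply/funext => c.
rewrite -[in RHS](coalg_counitr hC c) (linear_tlift _ _ FL).
by apply: eq_tlift => a b; rewrite linear_scale // bilinear_scaler // mul1r.
Qed.

End Convolution.

(** * Bialgebras through the product of the tensor square *)

Section Bialgebra.
Variables (K : fieldType) (A : lmodType K).
Variables (Delta : A -> A ⊗ A) (eps : A -> K^o).
Implicit Types mul : A -> A -> A.

(** The product of the algebra [A ⊗ A]: compatibility with [Delta] becomes multiplicativity of
    [Delta], without [tens_comul]. *)
Definition tens_mul mul (x y : A ⊗ A) : A ⊗ A :=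
  tlift (fun a1 a2 => tlift (fun b1 b2 => mul a1 b1 ⊗ mul a2 b2) y) x.

Lemma tens_mul_tens mul a b c d : is_bilinear mul ->
  tens_mul mul (a ⊗ b) (c ⊗ d) = mul a c ⊗ mul b d.
Proof.
have tB := @tens_bilinear K A A.
move=> mulB; have mulBr a1 a2 := bilinear_comp2 tB
  (bilinear_linr a1 mulB) (bilinear_linr a2 mulB).
rewrite /tens_mul tlift_tens ?tlift_tens //.
apply: tlift_bilinear_param => b1 b2.
exact: bilinear_comp2 tB (bilinear_linl _ mulB) (bilinear_linl _ mulB).
Qed.

Lemma tens_mul_grouplike mul g x : is_bilinear mul ->
  tens_mul mul x (g ⊗ g) = tmap (mul^~ g) (mul^~ g) x.
Proof.
move=> mulB; apply: eq_tlift => a1 a2; rewrite tlift_tens //.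
apply: bilinear_comp2 (@tens_bilinear K A A) _ _; exact: bilinear_linr.
Qed.

Lemma tens_interchange_bilinear : is_bilinear (fun x y : A ⊗ A =>
  tlift (fun a1 a2 => tlift (fun b1 b2 => (a1 ⊗ b1) ⊗ (a2 ⊗ b2)) y) x).
Proof.
have tB := @tens_bilinear K A A.
have tB2 := @tens_bilinear K (A ⊗ A)%type (A ⊗ A)%type.
apply: tlift_tlift_bilinear => c d.
  exact: (bilinear_comp2 tB2 (bilinear_linl _ tB) (bilinear_linl _ tB)).
exact: (bilinear_comp2 tB2 (bilinear_linr _ tB) (bilinear_linr _ tB)).
Qed.

Lemma tens_comul_tens a b : linear Delta ->
  tens_comul Delta Delta (a ⊗ b) =
  tlift (fun a1 a2 => tlift (fun b1 b2 => (a1 ⊗ b1) ⊗ (a2 ⊗ b2)) (Delta b))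
    (Delta a).
Proof.
move=> DL; rewrite /tens_comul tlift_tens //.
exact: (bilinear_comp2 tens_interchange_bilinear DL DL).
Qed.

Lemma tmap_tens_comul mul a b : linear Delta -> is_bilinear mul ->
  tmap (tlift mul) (tlift mul) (tens_comul Delta Delta (a ⊗ b)) =
  tens_mul mul (Delta a) (Delta b).
Proof.
move=> DL mulB; rewrite tens_comul_tens //.
have mB := bilinear_comp2 (@tens_bilinear K A A)
  (tlift_linear mulB) (tlift_linear mulB).
rewrite /tmap (linear_tlift _ _ (tlift_linear mB)); apply: eq_tlift => a1 a2.
rewrite (linear_tlift _ _ (tlift_linear mB)); apply: eq_tlift => b1 b2.
by rewrite !tlift_tens.
Qed.

Lemma linear_tensor_ext (U V W : lmodType K) (f g : U ⊗ V -> W) :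
  linear f -> linear g -> (forall a b, f (a ⊗ b) = g (a ⊗ b)) -> f =1 g.
Proof.
move=> fL gL fg x; rewrite (tens_sum x) !linear_sum_seq //.
exact: eq_bigr.
Qed.

Lemma counit_bilinear : linear eps ->
  is_bilinear (fun a b => eps a * eps b : K^o).
Proof.
move=> eL; apply: bilinear_intro => [b|a] k x y.
  by rewrite eL mulrDl scalerAl.
by rewrite eL mulrDr scalerAr.
Qed.

(** Both sides of each coalgebra-morphism condition are linear on [A ⊗ A], so pure tensors
    suffice. *)
Lemma nonunital_bialgebra_intro mul :
  is_coalgebra Delta eps -> is_bilinear mul -> associative mul ->
  (forall a b, Delta (mul a b) = tens_mul mul (Delta a) (Delta b)) ->
  (forall a b, eps (mul a b) = eps a * eps b) ->
  is_nonunital_bialgebra Delta eps mul.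
Proof.
move=> hC mulB mulA mulD mulE; have [DL eL _ _ _] := hC.
have mulL := tlift_linear mulB.
split=> //; split=> //.
  apply: linear_tensor_ext => [||a b].
  - exact: linear_comp DL mulL.
  - apply: linear_comp; last apply: tlift_linear.
      exact: tlift_linear (bilinear_comp2 (@tens_bilinear K A A) mulL mulL).
    exact: (bilinear_comp2 tens_interchange_bilinear DL DL).
  - by rewrite tlift_tens // mulD tmap_tens_comul.
apply: linear_tensor_ext => [||a b].
- exact: linear_comp eL mulL.
- exact: tlift_linear (counit_bilinear eL).
- by rewrite /tens_counit !tlift_tens //; apply: counit_bilinear.
Qed.

Section NonunitalBialgebraTheory.
Variable mul : A -> A -> A.
Hypothesis hB : is_nonunital_bialgebra Delta eps mul.

Lemma nubialg_comulM a b :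
  Delta (mul a b) = tens_mul mul (Delta a) (Delta b).
Proof.
have [[DL _ _ _ _] mulB _ mulC] := hB.
by rewrite -tmap_tens_comul // -(coalg_mor_comul mulC) tlift_tens.
Qed.

Lemma nubialg_counitM a b : eps (mul a b) = eps a * eps b.
Proof.
have [[_ eL _ _ _] mulB _ mulC] := hB.
have := coalg_mor_counit mulC (a ⊗ b).
by rewrite /tens_counit !tlift_tens //; apply: counit_bilinear.
Qed.

(** Applied to [circ], this makes right multiplication by [one] or [e] convolution invertible, and
    makes the new cocycle a coalgebra map. *)
Lemma mul_grouplike_coalg_morphism g : is_grouplike Delta eps g ->
  is_coalg_morphism Delta eps Delta eps (mul^~ g).
Proof.
have mulB := nubialg_bilinear hB; move=> [Dg eg].
split=> [|a|a]; first exact: bilinear_linl.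
  by rewrite nubialg_comulM Dg tens_mul_grouplike.
by rewrite nubialg_counitM eg mulr1.
Qed.

End NonunitalBialgebraTheory.
End Bialgebra.

(** * Antipodes, grouplike elements and the translated Hopf algebra *)

Section HopfAlgebra.
Variables (K : fieldType) (A : lmodType K).
Variables (Delta : A -> A ⊗ A) (eps : A -> K^o).
Variables (mul : A -> A -> A) (one : A) (S : A -> A).
Hypothesis hH : is_hopf_algebra Delta eps mul one S.

Let hB := bialg_nonunital (hopf_bialgebra hH).
Let hC := nubialg_coalgebra hB.
Let mulB := nubialg_bilinear hB.
Let mulA := nubialg_mulA hB.
Let mul1l := bialg_mul1l (hopf_bialgebra hH).
Let mul1r := bialg_mul1r (hopf_bialgebra hH).
Let SL := hopf_antipode_linear hH.

Lemma grouplike_one : is_grouplike Delta eps one.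
Proof. by case: (hopf_bialgebra hH). Qed.

(** Since [f] commutes with the coproducts, this is the antipode axiom at [f a]. *)
Lemma conv_antipodel (f : A -> A) :
  is_coalg_morphism Delta eps Delta eps f ->
  conv Delta mul (fun a => S (f a)) f = conv_unit eps one.
Proof.
move=> [fL fD fE]; apply/funext => a.
rewrite /conv_unit -fE -(hopf_antipodel hH) fD tlift_tmap //.
exact: bilinear_comp2 mulB SL (@linear_ident _ _).
Qed.

Lemma conv_antipoder (f : A -> A) :
  is_coalg_morphism Delta eps Delta eps f ->
  conv Delta mul f (fun a => S (f a)) = conv_unit eps one.
Proof.
move=> [fL fD fE]; apply/funext => a.
rewrite /conv_unit -fE -(hopf_antipoder hH) fD tlift_tmap //.
exact: bilinear_comp2 mulB (@linear_ident _ _) SL.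
Qed.

Section Grouplike.
Variable e : A.
Hypothesis he : is_grouplike Delta eps e.

Lemma grouplike_mulVg : mul (S e) e = one.
Proof.
have [De ee] := he; have := hopf_antipodel hH e.
rewrite De ee scale1r tlift_tens //.
exact: bilinear_comp2 mulB SL (@linear_ident _ _).
Qed.

Lemma grouplike_mulgV : mul e (S e) = one.
Proof.
have [De ee] := he; have := hopf_antipoder hH e.
rewrite De ee scale1r tlift_tens //.
exact: bilinear_comp2 mulB (@linear_ident _ _) SL.
Qed.

(** Multiplicativity of [Delta] on [mul (S e) e = one] shows that [Delta (S e)] times [e ⊗ e] is
    [one ⊗ one]; multiplying on the right by [S e ⊗ S e] isolates [Delta (S e)]. *)
Lemma grouplike_antipode : is_grouplike Delta eps (S e).
Proof.
have [De ee] := he; have [D1 e1] := grouplike_one; split; last first.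
  by have := nubialg_counitM hB (S e) e; rewrite grouplike_mulVg e1 ee mulr1.
have := nubialg_comulM hB (S e) e.
rewrite grouplike_mulVg D1 De tens_mul_grouplike // => DSe.
have := congr1 (tmap (mul^~ (S e)) (mul^~ (S e))) DSe.
rewrite -!tens_mul_grouplike // tens_mul_tens // mul1l => ->.
rewrite [X in tens_mul _ X _]tens_mul_grouplike // tens_mul_grouplike //.
rewrite {1}/tmap tlift_tmap; last first.
  apply: bilinear_comp2 (@tens_bilinear K A A) _ _; exact: bilinear_linl.
rewrite [LHS]tens_sum; apply: eq_bigr => p _.
by rewrite -!mulA grouplike_mulgV !mul1r.
Qed.

Let g := S e.
Let mul_e a b := mul (mul a g) b.

Lemma hopf_algebra_grouplike :
  is_hopf_algebra Delta eps mul_e e (fun a => mul (mul e (S a)) e).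
Proof.
have [De ee] := he; have [Dg eg] := grouplike_antipode.
have ge := grouplike_mulVg; have eg1 := grouplike_mulgV.
have mulgL := bilinear_linl g mulB.
split.
- split=> [|a|a||] //; rewrite /mul_e.
  + apply: nonunital_bialgebra_intro => // [|a b c|a b|a b].
    * exact: bilinear_comp2 mulB mulgL (@linear_ident _ _).
    * by rewrite /mul_e !mulA.
    * rewrite /mul_e !(nubialg_comulM hB) Dg tens_mul_grouplike //.
      rewrite /tens_mul tlift_tmap //.
      apply: tlift_bilinear_param => b1 b2.
      exact: bilinear_comp2 (@tens_bilinear _ _ _)
        (bilinear_linl _ mulB) (bilinear_linl _ mulB).
    * by rewrite /mul_e !(nubialg_counitM hB) eg mulr1.
  + by rewrite eg1 mul1l.
  + by rewrite -mulA ge mul1r.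
- apply: linear_comp (bilinear_linl e mulB) _.
  exact: linear_comp (bilinear_linr e mulB) SL.
(* In each summand [e] cancels against [g], leaving [e] times a summand of the old antipode axiom;
   the other side is symmetric. *)
- move=> a; transitivity (mul e (eps a *: one)); last first.
    by rewrite bilinear_scaler // mul1r.
  rewrite -(hopf_antipodel hH) (linear_tlift _ _ (bilinear_linr e mulB)).
  by apply: eq_tlift => a1 a2; rewrite /mul_e -!mulA (mulA e g) eg1 mul1l.
- move=> a; transitivity (mul (eps a *: one) e); last first.
    by rewrite bilinear_scalel // mul1l.
  rewrite -(hopf_antipoder hH) (linear_tlift _ _ (bilinear_linl e mulB)).
  by apply: eq_tlift => a1 a2; rewrite /mul_e -!mulA (mulA g e) ge mul1l.
Qed.

End Grouplike.
End HopfAlgebra.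

(** * The truss axiom in the convolution algebra *)

Section HopfTruss.
Variables (K : fieldType) (A : lmodType K).
Variables (Delta : A -> A ⊗ A) (eps : A -> K^o).
Variables (dia : A -> A -> A) (one : A) (S : A -> A).
Variables (circ : A -> A -> A) (sigma : A -> A).
Hypothesis hA : is_hopf_truss Delta eps dia one S circ sigma.

Let hH := truss_hopf hA.
Let hB := bialg_nonunital (hopf_bialgebra hH).
Let hC := nubialg_coalgebra hB.
Let diaB := nubialg_bilinear hB.
Let diaA := nubialg_mulA hB.
Let dia1l := bialg_mul1l (hopf_bialgebra hH).
Let dia1r := bialg_mul1r (hopf_bialgebra hH).
Let SL := hopf_antipode_linear hH.
Let circB := nubialg_bilinear (truss_circ hA).

Let R b a := circ a b.
Let T a := S (sigma a).
Let RL b : linear (R b) := bilinear_linl b circB.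
Let TL : linear T := linear_comp SL (coalg_mor_linear (truss_cocycle hA)).

Local Notation "F ** G" := (conv Delta dia F G)
  (at level 40, left associativity).
Local Notation "\1" := (conv_unit eps one).

Let convL F G : linear F -> linear G -> linear (F ** G).
Proof. exact: conv_linear hC diaB F G. Qed.

Let mulcA F G H : linear F -> linear G -> linear H ->
  F ** (G ** H) = F ** G ** H.
Proof. exact: convA hC diaB diaA F G H. Qed.

Let mul1c F : linear F -> \1 ** F = F.
Proof. exact: conv1l hC diaB dia1l F. Qed.

Let mulc1 F : linear F -> F ** \1 = F.
Proof. exact: conv1r hC diaB dia1r F. Qed.

Lemma truss_distr_conv b c : R (dia b c) = R b ** T ** R c.
Proof.
by apply/funext => a; rewrite conv3E // /R (truss_distr hA).
Qed.

Lemma truss_cocycleE a : circ a one = sigma a.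
Proof.
have R1 : is_coalg_morphism Delta eps Delta eps (R one).
  exact: (mul_grouplike_coalg_morphism (truss_circ hA) (grouplike_one hH)).
have SRL : linear (fun a => S (R one a)) := linear_comp SL (RL one).
have sL := coalg_mor_linear (truss_cocycle hA).
have TRL := convL TL (RL one).
(* The axiom at [b = c = one] reads [R one = R one ** T ** R one]; the left inverse of [R one]
   cancels one factor. *)
have TR1 : T ** R one = \1.
  rewrite -[LHS]mul1c // -[in LHS](conv_antipodel hH R1).
  rewrite -mulcA // (mulcA (RL one)) // -truss_distr_conv.
  by rewrite dia1l (conv_antipodel hH R1).
suff : R one = sigma by move=> /(congr1 (fun f => f a)).
(* [T] has left inverse [sigma] and right inverse [R one], so these agree. *)
rewrite -[LHS]mul1c // -(conv_antipoder hH (truss_cocycle hA)).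
by rewrite -mulcA // TR1 mulc1.
Qed.

Lemma antipode_circ_grouplike e : is_grouplike Delta eps e ->
  (fun a => S (circ a e)) = T ** R (S e) ** T.
Proof.
move=> he; have Re : is_coalg_morphism Delta eps Delta eps (R e).
  exact: (mul_grouplike_coalg_morphism (truss_circ hA) he).
have SRL : linear (fun a => S (R e a)) := linear_comp SL (RL e).
have TRL := convL TL (RL (S e)); have TRTL := convL TRL TL.
(* Here [sigma] is [R one], and [one] is split as [dia e (S e)]. *)
have sE : sigma = R e ** T ** R (S e).
  rewrite -truss_distr_conv (grouplike_mulgV hH he).
  by apply/funext => a; rewrite /R truss_cocycleE.
have inv : R e ** (T ** R (S e) ** T) = \1.
  rewrite (mulcA (RL e)) // (mulcA (RL e)) // -sE.
  exact: (conv_antipoder hH (truss_cocycle hA)).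
(* [S] after [R e] is a left inverse of [R e], and [inv] gives a right inverse; they coincide. *)
rewrite -[RHS]mul1c // -(conv_antipodel hH Re).
by rewrite -mulcA // inv mulc1.
Qed.

Lemma truss_distr_grouplike e b c : is_grouplike Delta eps e ->
  R (dia (dia b (S e)) c) = R b ** (fun a => S (circ a e)) ** R c.
Proof.
move=> he; rewrite antipode_circ_grouplike // !truss_distr_conv.
have TRL := convL TL (RL (S e)).
by rewrite (mulcA (RL b)) // (mulcA (RL b)).
Qed.

End HopfTruss.

Theorem proposition6p7 (K : fieldType) (A : lmodType K)
    (Delta : A -> A ⊗ A) (eps : A -> K^o)
    (dia : A -> A -> A) (one : A) (S : A -> A)
    (circ : A -> A -> A) (sigma : A -> A)
    (hA : is_hopf_truss Delta eps dia one S circ sigma)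
    (e : A) (he : is_grouplike Delta eps e) :
  let dia_e := fun a b => dia (dia a (S e)) b in
  let S_e := fun a => dia (dia e (S a)) e in
  let sigma_e := fun a => circ a e in
  is_hopf_algebra Delta eps dia_e e S_e /\
  is_hopf_truss Delta eps dia_e e S_e circ sigma_e.
Proof.
move=> dia_e S_e sigma_e; have hH := truss_hopf hA.
have hB := bialg_nonunital (hopf_bialgebra hH).
have diaB := nubialg_bilinear hB; have diaA := nubialg_mulA hB.
have circB := nubialg_bilinear (truss_circ hA).
have hHe := hopf_algebra_grouplike hH he.
split=> //; split=> [||| a b c]; first exact: hHe.
- exact: truss_circ hA.
- exact: (mul_grouplike_coalg_morphism (truss_circ hA) he).
have -> := congr1 (fun f => f a) (truss_distr_grouplike hA b c he).
rewrite conv3E //; last exact: bilinear_linl.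
- apply: eq_tlift => x a3; apply: eq_tlift => a1 a2.
  (* The factors [S e] inserted by [dia_e] cancel both factors [e] of [S_e], leaving only
     [S (circ a2 e)] in the middle. *)
  rewrite /dia_e /S_e -!diaA (diaA (S e) e) (grouplike_mulVg hH he).
  rewrite (bialg_mul1l (hopf_bialgebra hH)) (diaA e (S e)).
  by rewrite (grouplike_mulgV hH he) (bialg_mul1l (hopf_bialgebra hH)).
- exact: bilinear_linl.
- exact: linear_comp (hopf_antipode_linear hH) (bilinear_linl e circB).
Qed.
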